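(* For two-dimensional nearest neighbor branching random walk ($d=2$), the number $\Omega_n$ of occupied sites in generation $n$ is $O_P(n/\log n)$ given the event $G_n$.
   Context: Branching random walk: a nearest neighbor branching random walk on $\mathbb{Z}^d$ with offspring distribution $\mathcal{Q}=\{Q_l\}_{l\ge 0}$ evolves as follows: at each time $n=0,1,2,\dots$ every particle independently produces a random number of offspring with law $\mathcal{Q}$ (which replace it), and each offspring independently moves to a site chosen uniformly at random from the $2d+1$ sites at distance $\le 1$ from the location of its parent. Standing assumptions: $\mathcal{Q}$ has mean $1$ (criticality) and finite, positive variance $\sigma^2$; the process is started by a single particle at the origin at time $0$. Notation: $\Omega_n$ is the number of sites of $\mathbb{Z}^2$ occupied by at least one particle of generation $n$; $G_n$ is the event that the process survives to generation $n$ (at least one particle in generation $n$). For random variables $X_n$, positive reals $f(n)$ and events $H_n$ of positive probability: $X_n=O_P(f(n))$ given $H_n$ means that the conditional distributions of $X_n/f(n)$ given $H_n$ are tight. *)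

(* Defs.v *)
From HB Require Import structures.
From mathcomp Require Import all_boot all_order all_algebra finmap.
From mathcomp Require Import all_classical all_reals all_analysis.

Set Implicit Arguments.
Unset Strict Implicit.
Unset Printing Implicit Defensive.

Import Order.TTheory GRing.Theory Num.Theory.
Import numFieldNormedType.Exports.

Local Open Scope classical_set_scope.
Local Open Scope ring_scope.

(* An alias of 'rV[int]_dim that carries the discrete sigma-algebra. *)
Definition site (dim : nat) := 'rV[int]_dim.

HB.instance Definition _ (dim : nat) := GRing.Zmodule.on (site dim).
HB.instance Definition _ (dim : nat) := isPointed.Build (site dim) 0.
HB.instance Definition _ (dim : nat) :=
  @isMeasurable.Build default_measure_display (site dim)
    (@discrete_measurable (site dim)) (@discrete_measurable0 (site dim))
    (@discrete_measurableC (site dim)) (@discrete_measurableU (site dim)).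

(* For integer vectors the bounds 1 on the l^1, Euclidean and graph distances
   coincide, and they are met by exactly 2 * dim + 1 vectors. *)
Definition near0 (dim : nat) (e : site dim) : bool :=
  (\sum_j `|e ord0 j| <= 1)%R.

Definition mutually_independent (d : measure_display) (T : measurableType d)
    (R : realType) (P : probability T R) (I : choiceType)
    (F : I -> set (set T)) : Prop :=
  forall (J : {fset I}) (A : I -> set T),
    (forall i, i \in J -> F i (A i)) ->
    P (\big[setI/setT]_(i <- J) A i) = (\prod_(i <- J) P (A i))%E.

Definition sigma_of (d d' : measure_display) (T : measurableType d)
    (T' : measurableType d') (X : T -> T') : set (set T) :=
  preimage_set_system setT X measurable.

(* Potential particles are labelled by finite words over nat (Ulam-Harris
   labels): the empty word is the initial particle, and [i :: v] is the child
   number i of v (the most recent ancestor index comes first).  Every label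
   carries an offspring number and a displacement from its parent; the
   displacement of the empty word is never used. *)
Record brw (d : measure_display) (T : measurableType d) (R : realType)
    (P : probability T R) (dim : nat) (Q : probability nat R) := Brw {
  offspring : seq nat -> {RV P >-> nat};
  step : seq nat -> {RV P >-> site dim};
  offspring_law : forall v (A : set nat),
    distribution P (offspring v) A = Q A;
  step_law : forall v (e : site dim),
    distribution P (step v) [set e] =
      (if near0 e then (2 * dim + 1)%:R^-1 else 0)%:E;
  brw_independent :
    mutually_independent P (fun k : seq nat + seq nat =>
      match k with
      | inl v => sigma_of (offspring v)
      | inr v => sigma_of (step v)
      end)
}.

Section process.
Context (d : measure_display) (T : measurableType d) (R : realType)
  (P : probability T R) (dim : nat) (Q : probability nat R)
  (W : brw P dim Q).

Fixpoint generation (n : nat) (w : T) : seq (seq nat) :=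
  if n is n'.+1 then
    [seq i :: v | v <- generation n' w, i <- iota 0 (offspring W v w)]
  else [:: [::]].

Fixpoint position (v : seq nat) (w : T) : site dim :=
  if v is _ :: v' then position v' w + step W v w else 0.

Definition occupied (n : nat) (w : T) : nat :=
  size (undup [seq position v w | v <- generation n w]).

Definition survives (n : nat) : set T := [set w | (0 < size (generation n w))%N].

End process.

Definition cond_distribution (d : measure_display) (T : measurableType d)
    (R : realType) (P : probability T R) (X : T -> R) (H : set T)
    (B : set R) : \bar R :=
  (P (X @^-1` B `&` H) / P H)%E.

Definition tight (R : realType) (D : set nat) (mu : nat -> set R -> \bar R) :
    Prop :=
  forall eps : R, 0 < eps -> exists2 K : set R, compact K &
    forall n, D n -> ((1 - eps)%:E <= mu n K)%E.

(* D is the set of indices n at which f n is a positive real. *)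
Definition bigOP_given (d : measure_display) (T : measurableType d)
    (R : realType) (P : probability T R) (D : set nat) (X : nat -> T -> R)
    (f : nat -> R) (H : nat -> set T) : Prop :=
  tight D (fun n => cond_distribution P (fun w => X n w / f n) (H n)).

(* Main.v *)
Require Import Defs.
From mathcomp Require Import all_boot all_order all_algebra finmap.
From mathcomp Require Import ring lra zify.
From mathcomp Require Import all_classical all_reals all_analysis.
From mathcomp Require Import measurable_realfun.

Set Implicit Arguments.
Unset Strict Implicit.
Unset Printing Implicit Defensive.

Import Order.TTheory GRing.Theory Num.Theory.
Import numFieldNormedType.Exports.

Local Open Scope classical_set_scope.
Local Open Scope ring_scope.

(* Let u_n(x) be the probability that x is occupied in generation n, a_n(x) the
   average of u_n over the neighbours of x, and p_j the probability of having
   more than j children.  Looking for the first child whose descendance reaches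
   x gives u_{n+1} = sum_j p_j a_n (1 - a_n)^j <= a_n - p_1 a_n^2.  Let S_n be
   the sum of u_n.  The second moment of u_n is at most
   M_n = 1 + (4/5) sum_{k<n} S_k, so by Chebyshev half of the mass of a_n lies
   on O(M_n / S_n) sites (here d = 2 is used), and by Cauchy-Schwarz the sum of
   a_n^2 is at least c S_n^3 / M_n.  Hence 1/S_n grows at least at the rate
   c S_n / M_n, a multiple of the growth rate of ln M_n, and therefore
   1/S_n >= c' ln M_n.  If M_n >= sqrt n this yields S_n = O(1 / ln n); otherwise
   n S_n <= sum_{k<n} S_k = O(sqrt n), as S is nonincreasing.  The same recursion
   bounds the probability of survival to generation n from below by c / n, and
   Markov's inequality concludes. *)

(** * Decay of the expected number of occupied sites *)

Definition nbr : seq (int * int) :=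
  [:: (0, 0); (1, 0); (-1, 0); (0, 1); (0, -1)].

Definition zrange (n : nat) : seq int :=
  [seq i%:Z - n%:Z | i <- iota 0 (2 * n + 1)].

Definition box (n : nat) : seq (int * int) :=
  [seq (a, b) | a <- zrange n, b <- zrange n].

Lemma mem_zrange n a : (a \in zrange n) = (`|a| <= n%:Z).
Proof.
apply/mapP/idP => [[i]|an].
  rewrite mem_iota => /andP[_ iH] ->; lia.
exists (absz (a + n%:Z)); last by lia.
by rewrite mem_iota; lia.
Qed.

Lemma mem_box n x : (x \in box n) = (`|x.1| <= n%:Z) && (`|x.2| <= n%:Z).
Proof.
rewrite -!mem_zrange; apply/allpairsP/andP => [[[a b] /= [an bn ->]]//|[an bn]].
by exists (x.1, x.2); split => //; case: x {an bn}.
Qed.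

Lemma uniq_box n : uniq (box n).
Proof.
have uz : uniq (zrange n).
  by rewrite map_inj_uniq ?iota_uniq// => i j; lia.
by apply: allpairs_uniq => // -[a b] [c e].
Qed.

Lemma size_box n : size (box n) = ((2 * n + 1) ^ 2)%N.
Proof. by rewrite size_allpairs !size_map size_iota. Qed.

Section mass.
Context {R : realType}.

Definition normsq (x : int * int) : R := (x.1 ^+ 2 + x.2 ^+ 2)%:~R.

Lemma normsq_ge0 x : 0 <= normsq x.
Proof. by rewrite ler0z addr_ge0 ?sqr_ge0. Qed.

Lemma eq_sum_support (I : eqType) (f : I -> R) (s t : seq I) :
  uniq s -> uniq t ->
  (forall x, f x != 0 -> x \in s) -> (forall x, f x != 0 -> x \in t) ->
  \sum_(x <- s) f x = \sum_(x <- t) f x.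
Proof.
move=> us ut fs ft.
have E r : \sum_(x <- r) f x = \sum_(x <- r | f x != 0) f x.
  by rewrite [RHS]big_mkcond; apply: eq_bigr => x _; case: eqP.
rewrite (E s) (E t) -big_filter -[RHS]big_filter; apply: perm_big.
apply: uniq_perm; rewrite ?filter_uniq// => x; rewrite !mem_filter.
by case: eqP => //= /eqP fx; rewrite fs ?ft.
Qed.

(** Shifting by a neighbour keeps [box n] inside [box n.+1], so the change of variables loses no
    mass. *)
Lemma sum_box_shift n (u : int * int -> R) (g : int * int -> R) e :
  e \in nbr -> (forall x, x \notin box n -> u x = 0) ->
  \sum_(x <- box n.+1) g x * u (x - e) = \sum_(y <- box n) g (y + e) * u y.
Proof.
move=> en u0.
have -> : \sum_(x <- box n.+1) g x * u (x - e) =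
    \sum_(y <- [seq x - e | x <- box n.+1]) g (y + e) * u y.
  by rewrite big_map; apply: eq_bigr => x _; rewrite subrK.
have usub x : g (x + e) * u x != 0 -> x \in box n.
  by apply: contraR => /u0 ->; rewrite mulr0.
apply: eq_sum_support => // [||x /usub xn].
- by rewrite map_inj_uniq ?uniq_box// => x y /addIr.
- exact: uniq_box.
- apply/mapP; exists (x + e); last by rewrite addrK.
  move: xn en; rewrite !mem_box; case: x => a b /= abn.
  rewrite !inE; case: e {usub} => e1 e2 /=; rewrite !xpair_eqE.
  by move: abn; lia.
Qed.

(** With S the sum of f, Chebyshev's inequality puts at least S/2 on a box of radius about
    sqrt(2M/S), which has at most 18M/S points; by Cauchy-Schwarz the squares sum to at least
    (S/2)^2 / (18M/S). *)
Lemma sum_sqr_ge (s : seq (int * int)) (f : int * int -> R) (M : R) :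
  uniq s -> (forall x, 0 <= f x) -> 1 <= M ->
  0 < \sum_(x <- s) f x <= 1 -> \sum_(x <- s) normsq x * f x <= M ->
  (\sum_(x <- s) f x) ^+ 3 / (72%:R * M) <= \sum_(x <- s) f x ^+ 2.
Proof.
move=> us f0 M1 /andP[]; set S := \sum_(x <- s) f x => S0 S1 fM.
have M0 : 0 < M by lra.
have MS1 : 1 <= M / S by rewrite ler_pdivlMr//; lra.
(* Rounding down keeps both bounds: a point off the box has a coordinate of size at least r+1 >
   sqrt(2M/S), and r >= 1, from M/S >= 1, makes (2r+1)^2 at most 9r^2. *)
pose r := Num.truncn (Num.sqrt (2 * (M / S))).
have sq0 : 0 <= Num.sqrt (2 * (M / S)) by apply: sqrtr_ge0.
have sqE : Num.sqrt (2 * (M / S)) ^+ 2 = 2 * (M / S) by rewrite sqr_sqrtr//; lra.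
have /andP[rle rgt] := truncn_itv sq0.
rewrite -/r in rle rgt; clearbody r.
have r1 : (1 <= r)%N.
  rewrite -ltnS -(ltr_nat R); apply: le_lt_trans rgt.
  by rewrite -(@ler_pXn2r R 2)// ?nnegrE// sqE; lra.
have r1R : 1 <= r%:R :> R by rewrite ler1n.
pose K := 18 * (M / S).
have sizeK : (size (box r))%:R <= K.
  rewrite size_box natrX natrD natrM.
  have : r%:R ^+ 2 <= 2 * (M / S) by rewrite -sqE ler_pXn2r ?nnegrE ?ler0n.
  have : (2 * r%:R + 1) ^+ 2 <= 9 * r%:R ^+ 2 :> R.
    have -> : 9 * r%:R ^+ 2 = (3 * r%:R) ^+ 2 :> R by ring.
    by rewrite ler_pXn2r// ?nnegrE; lra.
  rewrite /K => h1 h2; apply: (le_trans h1).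
  have -> : 18 * (M / S) = 9 * (2 * (M / S)) by ring.
  by rewrite ler_pM2l.
have out x : x \notin box r -> 2 * (M / S) <= normsq x.
  rewrite mem_box negb_and -!ltNge => xr.
  apply: (@le_trans _ _ (r.+1%:R ^+ 2)).
    by rewrite -sqE ler_pXn2r ?nnegrE ?ler0n// ltW.
  rewrite -natrX /normsq -[X in X <= _]/((r.+1 ^ 2)%N%:Z%:~R) ler_int.
  have sqr_le (a : int) : r%:Z < `|a| -> (r.+1 ^ 2)%N%:Z <= a ^+ 2.
    move=> ra; rewrite -[a ^+ 2]real_normK ?num_real// -[_%:Z]natz natrX natz.
    by rewrite ler_pXn2r ?nnegrE.
  case/orP: xr => /sqr_le h; apply: (le_trans h).
    by rewrite lerDl sqr_ge0.
  by rewrite lerDr sqr_ge0.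
set T := \sum_(x <- s | x \in box r) f x.
have TS : S / 2 <= T.
  have : S = T + \sum_(x <- s | x \notin box r) f x by rewrite /S (bigID (mem (box r))).
  suff : 2 * (M / S) * (\sum_(x <- s | x \notin box r) f x) <= M.
    set O := \sum_(x <- s | _) f x.
    have -> : 2 * (M / S) * O = (2 * O / S) * M by field; rewrite gt_eqF.
    rewrite -[X in _ <= X]mul1r ler_pM2r// ler_pdivrMr//; lra.
  apply: le_trans fM; rewrite [leRHS](bigID (mem (box r)))/= mulr_sumr.
  rewrite -[leLHS]add0r lerD//.
    by apply: sumr_ge0 => x _; rewrite mulr_ge0 ?normsq_ge0.
  by apply: ler_sum => x xr; rewrite ler_wpM2r ?out.
have K0 : 0 < K by rewrite /K; lra.
(* With the level l = (S/2)/K, the inequality 2lf - l^2 <= f^2 summed over the box yields the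
   Cauchy-Schwarz bound (S/2)^2/K. *)
pose l := S / (2 * K).
have l0 : 0 <= l by rewrite divr_ge0// ltW//; lra.
have cnt : \sum_(x <- s | x \in box r) (1 : R) <= K.
  apply: le_trans sizeK; rewrite -big_filter big_const_seq count_predT iter_addr addr0 ler_nat.
  apply: uniq_leq_size; first exact: filter_uniq.
  by move=> x; rewrite mem_filter => /andP[].
apply: (@le_trans _ _ (2 * l * T - l ^+ 2 * K)).
  have -> : S ^+ 3 / (72%:R * M) = 2 * l * (S / 2) - l ^+ 2 * K.
    by rewrite /l /K; field; rewrite !gt_eqF.
  by rewrite lerB// ler_wpM2l// mulr_ge0.
apply: (@le_trans _ _ (2 * l * T - l ^+ 2 * \sum_(x <- s | x \in box r) 1)).
  by rewrite lerB// ler_wpM2l// sqr_ge0.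
rewrite /T !mulr_sumr -sumrB [leRHS](bigID (mem (box r)))/=.
rewrite -[leLHS]addr0 lerD//; last by apply: sumr_ge0 => x _; rewrite sqr_ge0.
apply: ler_sum => x _; rewrite mulr1.
have := sqr_ge0 (f x - l); rewrite sqrrB mulr2n; nra.
Qed.

Definition avg (v : int * int -> R) (x : int * int) : R :=
  5^-1 * \sum_(e <- nbr) v (x - e).

(** * The nonlinear recursion for the total mass *)

Section decay.
(** An abstract array is enough here; it will be the occupation probabilities, with p and q the
    probabilities of having at least one and at least two children. *)
Variables (u : nat -> int * int -> R) (p q : R).
Hypotheses (u_ge0 : forall n x, 0 <= u n x)
  (u_supp : forall n x, x \notin box n -> u n x = 0)
  (u00 : u 0 0 = 1) (p_gt0 : 0 < p) (q_gt0 : 0 < q)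
  (u_lower : forall n x, p * avg (u n) x <= u n.+1 x)
  (u_upper : forall n x, u n.+1 x <= avg (u n) x - q * avg (u n) x ^+ 2).

Let mass n := \sum_(x <- box n) u n x.
Let moment n := \sum_(x <- box n) normsq x * u n x.
(** An upper bound for the second moment, as 4/5 is the mean square length of a step; the added 1
    keeps it at least 1, as [sum_sqr_ge] requires. *)
Let spread n := 1 + 4 / 5 * \sum_(k < n) mass k.

Lemma avg_ge0 n x : 0 <= avg (u n) x.
Proof. by rewrite mulr_ge0// sumr_ge0. Qed.

Lemma sum_avg n : \sum_(x <- box n.+1) avg (u n) x = mass n.
Proof.
rewrite -mulr_sumr exchange_big /=.
have E e : e \in nbr -> \sum_(x <- box n.+1) u n (x - e) = mass n.
  move=> en; have := @sum_box_shift n (u n) (fun=> 1) e en (@u_supp n).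
  by under eq_bigr do rewrite mul1r; under [in RHS]eq_bigr do rewrite mul1r.
rewrite (eq_big_seq (fun=> mass n) E) /nbr !big_cons big_nil; by field.
Qed.

(** The terms linear in the step cancel over the symmetric set [nbr], and the squared steps average
    to 4/5. *)
Lemma sum_normsq_avg n :
  \sum_(x <- box n.+1) normsq x * avg (u n) x = moment n + 4 / 5 * mass n.
Proof.
transitivity (5^-1 * \sum_(e <- nbr) \sum_(x <- box n) normsq (x + e) * u n x).
  rewrite -(eq_big_seq _ (fun e en => @sum_box_shift n (u n) normsq e en (@u_supp n))).
  rewrite exchange_big /= mulr_sumr; apply: eq_bigr => x _.
  by rewrite /avg mulrCA mulr_sumr.
rewrite exchange_big /= /moment /mass !mulr_sumr -big_split /=; apply: eq_bigr => x _.
rewrite -mulr_suml /nbr !big_cons big_nil /normsq /= !addr0.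
rewrite !(rmorphD, rmorphXn, rmorphN, rmorphN1)/=; by field.
Qed.

(** The lower bound [u_lower] keeps the mass from vanishing, so that its inverse can be followed. *)
Lemma mass_gt0 n : 0 < mass n.
Proof.
elim: n => [|n IH].
  by rewrite /mass (_ : box 0 = [:: 0])// big_seq1 u00.
apply: (@lt_le_trans _ _ (p * mass n)); first exact: mulr_gt0.
by rewrite -sum_avg mulr_sumr; apply: ler_sum => x _; exact: u_lower.
Qed.

Lemma mass_succ_le n : mass n.+1 <= mass n - q * \sum_(x <- box n.+1) avg (u n) x ^+ 2.
Proof.
by rewrite -(sum_avg n) mulr_sumr -sumrB; apply: ler_sum => x _; exact: u_upper.
Qed.

Lemma mass_decr n : mass n.+1 <= mass n.
Proof.
apply: le_trans (mass_succ_le n) _; rewrite gerBl pmulr_rge0//.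
by apply: sumr_ge0 => x _; rewrite sqr_ge0.
Qed.

Lemma mass_le1 n : mass n <= 1.
Proof.
elim: n => [|n]; last exact/le_trans/mass_decr.
by rewrite /mass (_ : box 0 = [:: 0])// big_seq1 u00.
Qed.

Lemma spread_succ n : spread n.+1 = spread n + 4 / 5 * mass n.
Proof. by rewrite /spread big_ord_recr/= mulrDr addrA. Qed.

Lemma spread_ge1 n : 1 <= spread n.
Proof.
rewrite /spread lerDl mulr_ge0 ?divr_ge0// sumr_ge0// => k _.
exact/ltW/mass_gt0.
Qed.

Lemma moment_le n : moment n + 1 <= spread n.
Proof.
elim: n => [|n IH].
  rewrite /moment (_ : box 0 = [:: 0])// big_seq1 /normsq /= /spread big_ord0.
  by rewrite expr0n/= addr0 mul0r mulr0 addr0 add0r.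
rewrite spread_succ; apply: (@le_trans _ _ (moment n + 4 / 5 * mass n + 1)); last lra.
rewrite lerD2r -sum_normsq_avg; apply: ler_sum => x _.
rewrite ler_wpM2l ?normsq_ge0//; apply: le_trans (u_upper n x) _.
by rewrite gerBl pmulr_rge0// sqr_ge0.
Qed.

(** [sum_sqr_ge] is applied to the average of [u n]: it has the mass of [u n], and one step of the
    walk adds 4/5 of that mass to the second moment, hence [spread n.+1]. *)
Lemma mass_succ_le_cubic n : mass n.+1 <= mass n - q / 72 * (mass n ^+ 3 / spread n.+1).
Proof.
apply: le_trans (mass_succ_le n) _; rewrite lerB//.
have -> : q / 72 * (mass n ^+ 3 / spread n.+1) = q * (mass n ^+ 3 / (72 * spread n.+1)).
  by field; rewrite gt_eqF// (lt_le_trans _ (spread_ge1 _)).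
rewrite ler_pM2l// -(sum_avg n); apply: sum_sqr_ge.
- exact: uniq_box.
- by move=> x; exact: avg_ge0.
- exact: spread_ge1.
- by rewrite sum_avg mass_gt0 mass_le1.
- by rewrite sum_normsq_avg spread_succ; have := moment_le n; lra.
Qed.

(* Both [1 / mass] and [ln spread] grow at a rate of order [mass / spread]. *)
Lemma ln_spread_le n : q / 144 * ln (spread n) <= (mass n)^-1.
Proof.
elim: n => [|n IH].
  by rewrite /spread big_ord0 mulr0 addr0 ln1 mulr0 invr_ge0 ltW ?mass_gt0.
have S0 := mass_gt0 n; have S0' := mass_gt0 n.+1; have S1 := mass_le1 n.
have M1 := spread_ge1 n; have M1' := spread_ge1 n.+1.
have Mb0 : 0 < spread n by lra.
have Mb0' : 0 < spread n.+1 by lra.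
set X := mass n / spread n.+1.
have X0 : 0 < X by rewrite divr_gt0.
(* Since [mass n <= 1 <= spread n], one step multiplies [spread] by at most 9/5; with ln(1+x) <= x
   this gives 36/25 = 4/5 * 9/5. *)
have lnle : ln (spread n.+1) <= ln (spread n) + 36 / 25 * X.
  have -> : spread n.+1 = spread n * (1 + 4 / 5 * (mass n / spread n)).
    by rewrite spread_succ; field; rewrite gt_eqF.
  have pos : 0 < mass n / spread n by rewrite divr_gt0.
  rewrite lnM ?posrE//; last lra.
  rewrite lerD2l; apply: (@le_trans _ _ (4 / 5 * (mass n / spread n))).
    by apply: le_ln1Dx; lra.
  have : mass n / spread n <= 9 / 5 * X.
    rewrite /X mulrA ler_pdivrMr// mulrAC ler_pdivlMr// spread_succ.
    nra.
  lra.
(* 1/S' - 1/S = (S - S')/(S S') with S' <= S, so the cubic loss gives a gain of at least q/72 times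
   X. *)
have invS : (mass n)^-1 + q / 72 * X <= (mass n.+1)^-1.
  have St := mass_succ_le_cubic n; have Sd := mass_decr n.
  have -> : (mass n)^-1 = (mass n * mass n.+1)^-1 * mass n.+1.
    by field; rewrite !gt_eqF.
  have -> : (mass n.+1)^-1 = (mass n * mass n.+1)^-1 * mass n.
    by field; rewrite !gt_eqF.
  rewrite -lerBrDl -mulrBr.
  apply: (@le_trans _ _ ((mass n * mass n.+1)^-1 * (q / 72 * (mass n ^+ 3 / spread n.+1)))).
    have -> : (mass n * mass n.+1)^-1 * (q / 72 * (mass n ^+ 3 / spread n.+1)) =
       (q / 72 * X) * (mass n / mass n.+1).
      by rewrite /X; field; rewrite !gt_eqF.
    rewrite ler_peMr//; first by rewrite mulr_ge0 ?divr_ge0 ?ltW.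
    by rewrite ler_pdivlMr ?mul1r.
  by apply: ler_wpM2l; [rewrite invr_ge0 ltW// mulr_gt0|lra].
have : q / 144 * ln (spread n.+1) <= q / 144 * (ln (spread n) + 36 / 25 * X).
  by rewrite ler_wpM2l// ltW// divr_gt0.
have : 0 < q * X by rewrite mulr_gt0.
(* The increments compare because (36/25) / 144 = 1/100 is below 1/72. *)
nra.
Qed.

Lemma mass_noninc m n : (m <= n)%N -> mass n <= mass m.
Proof.
move=> /subnK <-; elim: (n - m)%N => // k IH.
exact: le_trans (mass_decr _) IH.
Qed.

Lemma total_mass_le :
  exists2 C : R, 0 < C &
    forall n, (2 <= n)%N -> \sum_(x <- box n) u n x <= C / ln n%:R.
Proof.
(* The first term serves when [spread n] is at least sqrt n, through ln n <= 2 ln (spread n); the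
   second otherwise, as then 4/5 n (mass n) < sqrt n, and ln n <= 2 sqrt n. *)
exists (288 / q + 5 / 2) => [|n n2]; first by rewrite addr_gt0 ?divr_gt0.
have ln0 : 0 < ln (n%:R : R) by rewrite ln_gt0// ltr1n.
rewrite -/(mass n) ler_pdivlMr//.
have n0 : 0 < n%:R :> R by rewrite ltr0n; lia.
have sn0 : 0 < Num.sqrt (n%:R : R) by rewrite sqrtr_gt0.
have lnsqrt : ln (n%:R : R) = 2 * ln (Num.sqrt (n%:R : R)).
  by rewrite -[in LHS](@sqr_sqrtr _ n%:R) ?ler0n// expr2 lnM ?posrE//; lra.
have S0 := mass_gt0 n.
have q0 : 0 < 288 / q by rewrite divr_gt0.
have [le|lt] := leP (Num.sqrt (n%:R : R)) (spread n).
  have lnle : ln (Num.sqrt (n%:R : R)) <= ln (spread n).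
    by rewrite ler_ln ?posrE//; apply: lt_le_trans le.
  have := ln_spread_le n; rewrite -[X in _ <= X]mul1r ler_pdivlMr// => H.
  have : ln n%:R <= 2 * ln (spread n) by lra.
  rewrite -(@ler_pM2l _ (mass n))// => H'.
  apply: (le_trans H').
  have : mass n * (2 * ln (spread n)) = 288 / q * (q / 144 * ln (spread n) * mass n).
    by field; rewrite gt_eqF.
  move=> ->; rewrite -[X in _ <= X]addr0 mulrC.
  set Y := _ * mass n in H *; nra.
have nS : n%:R * mass n <= \sum_(k < n) mass k.
  rewrite -[n%:R]/(n%:R : R) mulr_natl -[X in _ *+ X](card_ord n) -sumr_const.
  by apply: ler_sum => k _; apply: mass_noninc; rewrite ltnW.
have sqle : n%:R = Num.sqrt (n%:R : R) ^+ 2 by rewrite sqr_sqrtr ?ler0n.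
have lnle : ln (Num.sqrt (n%:R : R)) <= Num.sqrt (n%:R : R).
  have h : -1 < Num.sqrt (n%:R : R) - 1 by lra.
  by have := le_ln1Dx h; rewrite addrCA subrr addr0; lra.
rewrite /spread in lt; set Z := \sum_(k < n) mass k in lt nS.
set y := Num.sqrt _ in sn0 lnsqrt lt sqle lnle.
have ySn : y * mass n <= 5 / 4.
  have : y * (y * mass n) <= y * (5 / 4) by rewrite mulrA -expr2 -sqle; lra.
  by rewrite ler_pM2l.
have : mass n * ln n%:R <= mass n * (2 * y) by rewrite ler_pM2l// lnsqrt; lra.
nra.
Qed.

End decay.
End mass.

(** * Independence of disjoint blocks of an independent family *)

Section block_independence.
Context (d : measure_display) (T : measurableType d) (R : realType)
  (P : probability T R) (I : choiceType) (F : I -> set (set T)).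
Hypotheses (Fm : forall i, F i `<=` measurable)
  (FI : forall i, setI_closed (F i)) (FT : forall i, F i setT)
  (Find : mutually_independent P F).

Definition block (J : set I) : set (set T) := <<s \bigcup_(k in J) F k >>.

(** These finite intersections form a pi-system whose sigma-algebra contains [block J]. *)
Let cyl (J : set I) : set (set T) :=
  [set C | exists K : {fset I}, exists A : I -> set T,
    [/\ forall i, i \in K -> J i, forall i, i \in K -> F i (A i) &
        C = \bigcap_(i in [set i | i \in K]) A i]].

Lemma block_measurable (J : set I) : block J `<=` measurable.
Proof.
apply: smallest_sub; first exact: sigma_algebra_measurable.
by move=> A [i _ /Fm].
Qed.

Lemma cyl_measurable (J : set I) : cyl J `<=` measurable.
Proof.
move=> _ [K [A [_ KF ->]]]; rewrite bigcap_fset.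
by rewrite big_seq; apply: bigsetI_measurable => i /KF /Fm.
Qed.

Lemma setI_closed_cyl (J : set I) : setI_closed (cyl J).
Proof.
move=> _ _ [K [A [KJ KF ->]]] [L [B [LJ LF ->]]].
exists (K `|` L)%fset.
(* Indices missing from one of the two families get the whole space, which [FT] admits. *)
exists (fun i => (if i \in K then A i else setT) `&`
                 (if i \in L then B i else setT)); split.
- by move=> i; rewrite inE => /orP[/KJ|/LJ].
- move=> i _; apply: FI.
    by case: ifPn => // iK; apply: KF.
  by case: ifPn => // iL; apply: LF.
- apply/seteqP; split => [x [xA xB] i /= _|x xAB].
    by split; case: ifPn => // ?; [apply: xA|apply: xB].
  split=> i /= iK; have /xAB[] : (i \in K `|` L)%fset by rewrite inE iK ?orbT.
    by rewrite iK.
  by rewrite iK.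
Qed.

Lemma sub_block_cyl (J : set I) : block J `<=` <<s cyl J >>.
Proof.
apply: sub_sigma_algebra2 => A [i Ji FA].
exists [fset i]%fset, (fun=> A); split.
- by move=> j; rewrite inE => /eqP ->.
- by move=> j; rewrite inE => /eqP ->.
- apply/seteqP; split => [x Ax j //|x]; apply.
  by rewrite /= inE.
Qed.

(** Over disjoint index sets the two families glue into one family C, so independence factorises the
    intersections over U, over V and over their union. *)
Lemma cyl_indep (J K : set I) A B : J `&` K = set0 -> cyl J A -> cyl K B ->
  P (A `&` B) = (P A * P B)%E.
Proof.
move=> JK [U [A' [UJ UF ->]]] [V [B' [VK VF ->]]].
have UV : [disjoint U & V]%fset.
  apply/fdisjointP => i /UJ Ji; apply/negP => /VK Ki.
  by have : (J `&` K) i by []; rewrite JK.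
pose C i := if i \in U then A' i else B' i.
have EU i : i \in U -> C i = A' i by rewrite /C => ->.
have EV i : i \in V -> C i = B' i.
  rewrite /C; case: ifPn => // iU iV.
  by move/fdisjointP : UV => /(_ _ iU); rewrite iV.
rewrite !bigcap_fset (eq_big_seq C (fun i iU => esym (EU i iU))).
rewrite (eq_big_seq C (fun i iV => esym (EV i iV))).
have CF i : i \in (U `|` V)%fset -> F i (C i).
  by rewrite inE => /orP[iU|iV]; [rewrite EU//; exact: UF|rewrite EV//; exact: VF].
have UVE : perm_eq (U `|` V)%fset (enum_fset U ++ enum_fset V).
  apply: uniq_perm; rewrite ?fset_uniq ?cat_uniq ?fset_uniq ?andbT//=.
    apply/hasPn => i iV; apply/negP => iU.
    by move/fdisjointP : UV => /(_ _ iU); rewrite iV.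
  by move=> i; rewrite inE mem_cat.
have EP := perm_big _ UVE; rewrite -big_cat -EP /=.
have CU i : i \in U -> F i (C i) by move=> iU; apply: CF; rewrite inE iU.
have CV i : i \in V -> F i (C i) by move=> iV; apply: CF; rewrite inE iV orbT.
by rewrite (Find CF) (Find CU) (Find CV) (perm_big _ UVE) big_cat.
Qed.

Lemma dynkin_indep B : measurable B ->
  dynkin [set A | measurable A /\ P (A `&` B) = (P A * P B)%E].
Proof.
move=> mB; split.
- by split => //; rewrite setTI probability_setT mul1e.
- move=> A [mA AB]; split; first exact: measurableC.
  have fA : P A \is a fin_num by exact: fin_num_measure.
  have fB : P B \is a fin_num by exact: fin_num_measure.
  rewrite probability_setC// muleBl ?fin_num_adde_defr// mul1e -AB setIC -setDE.
  by rewrite measureD// ?[B `&` A]setIC -?ge0_fin_numE.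
- move=> A tA HA; split; first by apply: bigcupT_measurable => i; have [] := HA i.
  rewrite setI_bigcupl measure_bigcup//=; last 2 first.
    by move=> i _; apply: measurableI => //; have [] := HA i.
    by apply: trivIset_setIr.
  rewrite measure_bigcup//=; last by move=> i _; have [] := HA i.
  have fB : P B \is a fin_num by exact: fin_num_measure.
  rewrite muleC -(fineK fB) -nneseriesZl//.
  by apply: eq_eseriesr => i _; rewrite (fineK fB) muleC; have [_] := HA i.
Qed.

(** Dynkin's pi-lambda theorem twice: [A] is first extended from cylinders to [block J] against a
    cylinder of K, then [B] from cylinders to [block K] against the fixed [A]. *)
Lemma block_indep (J K : set I) A B : J `&` K = set0 ->
  block J A -> block K B -> P (A `&` B) = (P A * P B)%E.
Proof.
move=> JK JA KB.
have mA := block_measurable JA; have mB := block_measurable KB.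
have step1 C : cyl K C -> P (A `&` C) = (P A * P C)%E.
  move=> KC; have mC := cyl_measurable KC.
  have lam := (dynkin_lambda_system _).1 (dynkin_indep mC).
  suff /(_ A (sub_block_cyl JA))[] : <<s cyl J >> `<=`
    [set A | measurable A /\ P (A `&` C) = (P A * P C)%E] by [].
  apply: lambda_system_subset => //; first exact: setI_closed_cyl.
  by move=> D JD; split; [exact: cyl_measurable JD|exact: cyl_indep JK JD KC].
have lam := (dynkin_lambda_system _).1 (dynkin_indep mA).
suff /(_ B (sub_block_cyl KB))[_] : <<s cyl K >> `<=`
    [set B | measurable B /\ P (B `&` A) = (P B * P A)%E].
  by rewrite setIC muleC.
apply: lambda_system_subset => //; first exact: setI_closed_cyl.
move=> D KD; split; first exact: cyl_measurable KD.
by rewrite setIC muleC; exact: step1.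
Qed.

Lemma sub_block (J K : set I) A : J `<=` K -> block J A -> block K A.
Proof. by move=> JK; apply: sub_sigma_algebra2; exact: bigcup_subset. Qed.

Lemma block_in (J : set I) i A : J i -> F i A -> block J A.
Proof. by move=> Ji FA; apply: sub_sigma_algebra; exists i. Qed.

End block_independence.

(** * Critical offspring laws *)

Section offspring_tail.
Context {R : realType} (Q : probability nat R).

Definition tail (j : nat) : R := fine (Q [set l | (j < l)%N]).

Lemma tailE j : Q [set l | (j < l)%N] = (tail j)%:E.
Proof. by rewrite fineK// fin_num_measure. Qed.

Lemma tail_ge0 j : 0 <= tail j.
Proof. exact: fine_ge0. Qed.

Lemma tail_le i j : (i <= j)%N -> tail j <= tail i.
Proof.
move=> ij; rewrite -lee_fin -!tailE le_measure ?inE//.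
by move=> l /= jl; apply: leq_ltn_trans jl.
Qed.

Lemma integral_tail j : (\int[Q]_l (j < l)%N%:R%:E = (tail j)%:E)%E.
Proof.
rewrite -tailE -[X in Q X]setIT -integral_indic//.
apply: eq_integral => l _; rewrite indicE.
have -> // : (l \in [set l | (j < l)%N]) = (j < l)%N.
by apply/idP/idP => [/set_mem//|jl]; exact/mem_set.
Qed.

(** Swapping sum and integral; the weights needed are 1, for the mean, and j, for the second
    moment. *)
Lemma sum_tail (a : nat -> R) N : (forall j, 0 <= a j) ->
  ((\sum_(j < N) a j * tail j)%:E =
    \int[Q]_l (\sum_(j < N) a j * (j < l)%N%:R)%:E)%E.
Proof.
move=> a0; under eq_integral do rewrite -sumEFin.
rewrite ge0_integral_sum//; last by move=> j l _; rewrite lee_fin mulr_ge0.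
rewrite -sumEFin; apply: eq_bigr => j _.
under eq_integral do rewrite EFinM.
by rewrite ge0_integralZl ?lee_fin// integral_tail.
Qed.

Lemma sum_ltn_bool (N l : nat) : (\sum_(j < N) (j < l)%N = minn N l)%N.
Proof.
elim: N => [|N IH]; first by rewrite big_ord0 min0n.
by rewrite big_ord_recr /= IH; case: ltnP; lia.
Qed.

Hypothesis Qmean : ('E_Q[fun l : nat => l%:R] = 1)%E.

Lemma integral_id : (\int[Q]_l (l%:R)%:E = 1)%E.
Proof. by move: Qmean; rewrite unlock. Qed.

Lemma sum_tail_le1 N : \sum_(j < N) tail j <= 1.
Proof.
have := @sum_tail (fun=> 1) N (fun=> ler01); under eq_bigr do rewrite mul1r.
move=> E; rewrite -lee_fin E -integral_id; apply: ge0_le_integral => //=.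
- by move=> l _; rewrite lee_fin sumr_ge0// => j _; rewrite mul1r.
- move=> l _; rewrite lee_fin; under eq_bigr do rewrite mul1r.
  by rewrite -natr_sum ler_nat sum_ltn_bool geq_minr.
Qed.

(** The partial sums integrate min(N, l), which increases to l, so monotone convergence leads to the
    mean. *)
Lemma cvg_sum_tail : (fun N => \sum_(j < N) tail j) @ \oo --> (1 : R).
Proof.
have H : (fun N => (\sum_(j < N) tail j)%:E) @ \oo --> (1 : \bar R)%E.
  pose g (N l : nat) : \bar R := (minn N l)%:R%:E.
  have -> : (fun N => (\sum_(j < N) tail j)%:E) = (fun N => \int[Q]_l g N l)%E.
    apply/funext => N; have := @sum_tail (fun=> 1) N (fun=> ler01).
    under eq_bigr do rewrite mul1r; move=> ->; apply: eq_integral => l _.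
    by under eq_bigr do rewrite mul1r; rewrite -natr_sum sum_ltn_bool.
  rewrite -integral_id.
  rewrite [X in _ --> X](_ : _ = \int[Q]_l limn (g ^~ l))%E; last first.
    apply: eq_integral => l _; apply/esym/cvg_lim => //.
    apply: cvg_near_cst; exists l => // N /= lN.
    by rewrite /g; congr (_%:R%:E); lia.
  apply: cvg_monotone_convergence => //.
  - by move=> N l _; rewrite lee_fin.
  - by move=> l _ M N MN; rewrite lee_fin ler_nat; lia.
by move/fine_cvgP : H => [].
Qed.

(** Otherwise all tails vanish, against their sum being 1. *)
Lemma tail0_gt0 : 0 < tail 0.
Proof.
rewrite lt_neqAle tail_ge0 andbT eq_sym; apply/eqP => t0.
have : (fun N => \sum_(j < N) tail j) @ \oo --> (0 : R).
  rewrite (_ : (fun N => _) = cst 0); first exact: cvg_cst.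
  apply/funext => N; apply: big1 => j _; apply/eqP.
  by rewrite eq_le tail_ge0 andbT -t0 tail_le.
move=> /(cvg_unique (@Rhausdorff R)) /(_ cvg_sum_tail) /eqP.
by rewrite eq_sym oner_eq0.
Qed.

Hypothesis Qvar : (0 < 'V_Q[fun l : nat => l%:R] < +oo)%E.

Lemma varE : ('V_Q[fun l : nat => l%:R] = \int[Q]_l ((l%:R - 1) ^+ 2)%:E)%E.
Proof. by rewrite /variance unlock Qmean/= unlock. Qed.

(** Otherwise l is almost surely 0 or 1, where (l - 1)^2 + l = 1; integrating would give variance
    0. *)
Lemma tail1_gt0 : 0 < tail 1.
Proof.
rewrite lt_neqAle tail_ge0 andbT eq_sym; apply/eqP => t1.
have : (\int[Q]_l ((l%:R - 1) ^+ 2)%:E + \int[Q]_l (l%:R)%:E = 1)%E.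
  rewrite -ge0_integralD//; last by move=> l _; rewrite lee_fin sqr_ge0.
  rewrite (@ge0_ae_eq_integral _ _ _ _ _ _ (cst 1%E))//.
  - by rewrite integral_cst// mul1e; exact: probability_setT.
  - by move=> l _; rewrite -EFinD lee_fin addr_ge0// sqr_ge0.
  - exists [set l | (1 < l)%N]; split => //; first by have := tailE 1; rewrite t1.
    move=> l /= H; rewrite ltnNge; apply/negP => l1; apply: H => _.
    by rewrite -EFinD; congr (_%:E); case: l l1 => [|[|//]] _; rewrite ?subrr; ring.
rewrite integral_id -varE; have /andP[v0 voo] := Qvar.
have /fineK <- : 'V_Q[fun l : nat => l%:R]%E \is a fin_num.
  by rewrite ge0_fin_numE// ltW.
rewrite -EFinD => -[E]; have := @fine_gt0 _ ('V_Q[fun l : nat => l%:R])%E.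
rewrite v0 voo => /(_ isT); lra.
Qed.

Lemma sum_mul_tail_bounded :
  exists2 b : R, 0 < b & forall N, \sum_(j < N) j%:R * tail j <= b.
Proof.
have [v0 voo] := andP Qvar.
pose V := fine ('V_Q[fun l : nat => l%:R])%E.
have VE : (V%:E = \int[Q]_l ((l%:R - 1) ^+ 2)%:E)%E.
  by rewrite -varE fineK// ge0_fin_numE// ltW.
(* Pointwise, the sum of the j < min(N, l) is at most l^2, and l^2 <= 2 (l - 1)^2 + 2 brings in the
   variance. *)
exists (2 * V + 2) => [|N].
  have V0 : 0 < V by rewrite fine_gt0// v0 voo.
  lra.
rewrite -lee_fin sum_tail//.
have -> : ((2 * V + 2)%:E = \int[Q]_l (2 * ((l%:R - 1) ^+ 2) + 2)%:E)%E.
  under eq_integral do rewrite EFinD.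
  rewrite ge0_integralD//; last by move=> l _; rewrite lee_fin mulr_ge0// sqr_ge0.
  under eq_integral do rewrite EFinM.
  rewrite ge0_integralZl//; last by move=> l _; rewrite lee_fin sqr_ge0.
  by rewrite -VE integral_cst// (_ : _ [set: nat] = 1%E) ?mule1//; exact: probability_setT.
apply: ge0_le_integral => //=.
- by move=> l _; rewrite lee_fin sumr_ge0// => j _; rewrite mulr_ge0.
- move=> l _; rewrite lee_fin; apply: (@le_trans _ _ (l%:R ^+ 2)).
    apply: (@le_trans _ _ (l%:R * \sum_(j < N) (j < l)%N%:R)).
      rewrite mulr_sumr; apply: ler_sum => j _.
      by case: ltnP => jl; rewrite ?mulr0// !mulr1 ler_nat ltnW.
    by rewrite expr2 ler_wpM2l// -natr_sum ler_nat sum_ltn_bool geq_minr.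
  have := sqr_ge0 (l%:R - 2 : R); rewrite !expr2; lra.
Qed.

(* The probability that some member of a critical family succeeds, when the
   children succeed independently of each other with probability c: the j-th
   term is the probability that child j is the first to succeed. *)
Definition success (c : R) : \bar R :=
  (\sum_(0 <= j <oo) (tail j * (c * (1 - c) ^+ j))%:E)%E.

Section success_bounds.
Variables (c s : R).
Hypotheses (c01 : 0 <= c <= 1) (succE : success c = s%:E).

Let term_ge0 j : 0 <= tail j * (c * (1 - c) ^+ j).
Proof.
have /andP[c0 c1] := c01.
by rewrite mulr_ge0 ?tail_ge0// mulr_ge0// exprn_ge0// subr_ge0.
Qed.

Let partial_le N : \sum_(j < N) tail j * (c * (1 - c) ^+ j) <= s.
Proof.
rewrite -lee_fin -succE -sumEFin.
rewrite -(big_mkord xpredT (fun j => (tail j * (c * (1 - c) ^+ j))%:E)).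
by apply: nneseries_lim_ge => j _ _; rewrite lee_fin.
Qed.

Lemma success_ge_tail0 : tail 0 * c <= s.
Proof. by have := partial_le 1; rewrite big_ord1 expr0 mulr1. Qed.

(** The terms 0 and 1 are kept exactly, in the others (1 - c)^j is bounded by 1, and the tails sum
    to at most 1; the quadratic loss comes from term 1. *)
Lemma success_le : s <= c - tail 1 * c ^+ 2.
Proof.
have /andP[c0 c1] := c01.
rewrite -lee_fin -succE; apply: lime_le.
  by apply: is_cvg_nneseries => j _ _; rewrite lee_fin.
exists 2%N => // -[|[|N]] //= _.
rewrite big_mkord sumEFin lee_fin !big_ord_recl /= expr0 expr1.
have : \sum_(i < N) tail (bump 0 (bump 0 i)) *
    (c * (1 - c) ^+ (bump 0 (bump 0 i))) <=
    c * \sum_(i < N) tail (bump 0 (bump 0 i)).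
  rewrite mulr_sumr; apply: ler_sum => i _; rewrite [leRHS]mulrC ler_wpM2l ?tail_ge0//.
  by rewrite ler_piMr// exprn_ile1//; lra.
have := sum_tail_le1 N.+2; rewrite !big_ord_recl /=.
set X := \sum_(i < N) tail _; set Y := \sum_(i < N) _ => X1 YX.
have -> : tail 1 = tail (bump 0 0) by [].
have := ler_wpM2l c0 X1; lra.
Qed.

(** Bernoulli's inequality (1 - c)^j >= 1 - jc is summed against the tails, whose partial sums tend
    to 1. *)
Lemma success_ge b : (forall N, \sum_(j < N) j%:R * tail j <= b) ->
  c - b * c ^+ 2 <= s.
Proof.
have /andP[c0 c1] := c01; move=> bP.
have H N : c * \sum_(j < N) tail j - b * c ^+ 2 <= s.
  apply: le_trans (partial_le N).
  apply: (@le_trans _ _ (c * \sum_(j < N) tail j - (\sum_(j < N) j%:R * tail j) * c ^+ 2)).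
    by rewrite lerB// ler_wpM2r ?sqr_ge0.
  rewrite mulr_sumr mulr_suml -sumrB; apply: ler_sum => j _.
  have bern : 1 - j%:R * c <= (1 - c) ^+ j.
    elim: (nat_of_ord j) => [|k IH]; first by rewrite mul0r subr0 expr0.
    rewrite exprS; apply: (@le_trans _ _ ((1 - c) * (1 - k%:R * c))).
      by rewrite -natr1; have : 0 <= k%:R * c ^+ 2; [rewrite mulr_ge0// sqr_ge0|nra].
    by rewrite ler_wpM2l//; lra.
  have -> : c * tail j - j%:R * tail j * c ^+ 2 =
      tail j * (c * (1 - j%:R * c)) by ring.
  by rewrite ler_wpM2l ?tail_ge0// ler_wpM2l.
have cv : (fun N => c * (\sum_(j < N) tail j) - b * c ^+ 2) @ \oo --> c * 1 - b * c ^+ 2.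
  by apply: cvgB; [apply: cvgM; [exact: cvg_cst|exact: cvg_sum_tail]|exact: cvg_cst].
rewrite mulr1 in cv.
rewrite -(cvg_lim (@Rhausdorff R) cv); apply: limr_le.
  by apply/cvg_ex; exists (c - b * c ^+ 2).
by near=> N; exact: H.
Unshelve. all: by end_near. Qed.

End success_bounds.
End offspring_tail.

(** * Recursion over the first generation *)

Definition to_site (x : int * int) : site 2 :=
  \row_j (if j == ord0 then x.1 else x.2).

Lemma to_site_inj : injective to_site.
Proof.
move=> [a b] [a' b'] /rowP E; have := E ord0; have := E ord_max.
by rewrite !mxE /= => -> ->.
Qed.

Lemma to_siteB x y : to_site (x - y) = to_site x - to_site y.
Proof. by apply/rowP => j; rewrite !mxE; case: ifP. Qed.

Lemma to_site0 : to_site 0 = 0.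
Proof. by apply/rowP => j; rewrite !mxE; case: ifP. Qed.

Lemma to_site_surj e : exists x, e = to_site x.
Proof.
exists (e ord0 ord0, e ord0 ord_max); apply/rowP => -[[|[|//]] jlt]; rewrite !mxE/=.
  by congr (e _ _); apply/val_inj.
by congr (e _ _); apply/val_inj.
Qed.

Lemma near0_to_site x : x \in nbr -> near0 (to_site x).
Proof.
move=> xn; rewrite /near0 big_ord_recl big_ord1 !mxE /=.
by move: xn; rewrite !inE => /orP[|/orP[|/orP[|/orP[|]]]] /eqP ->.
Qed.

Section brw_hit.
Context (d : measure_display) (T : measurableType d) (R : realType)
  (P : probability T R) (Q : probability nat R) (W : brw P 2 Q).

Let label := (seq nat + seq nat)%type.

Definition sources (k : label) : set (set T) :=
  match k with
  | inl v => sigma_of (offspring W v)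
  | inr v => sigma_of (step W v)
  end.

Lemma sources_measurable k : sources k `<=` measurable.
Proof.
case: k => v _ [B mB <-] /=; rewrite setTI; exact: measurable_funPTI.
Qed.

Lemma setI_closed_sources k : setI_closed (sources k).
Proof.
case: k => v _ _ [B mB <-] [C mC <-].
  by exists (B `&` C); [exact: measurableI|rewrite !setTI preimage_setI].
by exists (B `&` C); [exact: measurableI|rewrite !setTI preimage_setI].
Qed.

Lemma setT_sources k : sources k setT.
Proof.
by case: k => v; exists setT; rewrite ?preimage_setT ?setTI//; exact: measurableT.
Qed.

Definition word (k : label) := match k with inl v => v | inr v => v end.

(* The variables that drive the descendance of s, its own displacement
   included; [inner] leaves out the displacement. *)
Definition outer (s : seq nat) : set label :=
  [set k | exists u, word k = u ++ s].

Definition inner (r : seq nat) : set label :=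
  [set k | k = inl r \/ exists i, outer (i :: r) k].

(** A word has only one suffix of a given length. *)
Lemma outer_disjoint i j r : i != j -> outer (i :: r) `&` outer (j :: r) = set0.
Proof.
move=> ij; rewrite -subset0 => k [[u uk] [u']]; rewrite uk.
move=> uu'; have suu' : size u = size u'.
  by have := congr1 size uu'; rewrite !size_cat /=; lia.
by move/eqP: uu'; rewrite eqseq_cat// eqseq_cons (negbTE ij) andbF.
Qed.

Lemma cat_neq_self (s u : seq nat) i : s <> u ++ i :: s.
Proof. by move=> /(congr1 size); rewrite size_cat /=; lia. Qed.

Lemma inl_notin_outer i r : ~ outer (i :: r) (inl r).
Proof. by move=> [u /= /cat_neq_self]. Qed.

Lemma inr_notin_inner r : ~ inner r (inr r).
Proof. by move=> [//|[i [u /= /cat_neq_self]]]. Qed.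

Lemma inner_outer r : inner r `<=` outer r.
Proof.
move=> k [->|[i [u uk]]]; first by exists [::].
by exists (rcons u i); rewrite cat_rcons.
Qed.

Local Notation blk := (block sources).

Lemma blk_measurable J : blk J `<=` measurable.
Proof. exact/block_measurable/sources_measurable. Qed.

Lemma blkI J A B : blk J A -> blk J B -> blk J (A `&` B).
Proof. exact: (@measurableI _ (g_sigma_algebraType (\bigcup_(k in J) sources k))). Qed.

Lemma blkC J A : blk J A -> blk J (~` A).
Proof. exact: (@measurableC _ (g_sigma_algebraType (\bigcup_(k in J) sources k))). Qed.

Lemma blkT J : blk J setT.
Proof. exact: (@measurableT _ (g_sigma_algebraType (\bigcup_(k in J) sources k))). Qed.

Lemma blk_bigcup J (I : countType) (A : I -> set T) :
  (forall i, blk J (A i)) -> blk J (\bigcup_i A i).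
Proof.
apply: (@countable_bigcupT_measurable _
  (g_sigma_algebraType (\bigcup_(k in J) sources k))).
exact: countableP.
Qed.

Lemma blk_indep (J K : set label) A B : J `&` K = set0 ->
  blk J A -> blk K B -> P (A `&` B) = (P A * P B)%E.
Proof.
move=> JK; apply: block_indep JK => //.
- exact: sources_measurable.
- exact: setI_closed_sources.
- exact: setT_sources.
- exact: brw_independent.
Qed.

(** The set A is relative to the position of r and is translated at each step, so that the event
    involves only the variables in [inner r] and its law does not depend on r. *)
Fixpoint hit (n : nat) (A : set (site 2)) (r : seq nat) (w : T) : Prop :=
  if n is n'.+1 then
    exists2 i, (i < offspring W r w)%N &
      hit n' [set x | A (step W (i :: r) w + x)] (i :: r) w
  else A 0.

(** The child i is followed whether it is born or not, which keeps the event independent of the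
    offspring number of r. *)
Definition childhit n (A : set (site 2)) r i : set T :=
  [set w | hit n [set x | A (step W (i :: r) w + x)] (i :: r) w].

Lemma blk_offspring j r : blk [set inl r] [set w | (j < offspring W r w)%N].
Proof.
apply: (@block_in _ _ _ sources _ (inl r) _ erefl).
by exists [set l | (j < l)%N] => //; rewrite setTI.
Qed.

Lemma blk_step e r : blk [set inr r] [set w | step W r w = e].
Proof.
apply: (@block_in _ _ _ sources _ (inr r) _ erefl).
by exists [set e] => //; rewrite setTI.
Qed.

(** The translated target is random; it is made deterministic by a countable union over the values
    of the step. *)
Lemma blk_childhit n A r i : (forall B, blk (inner (i :: r)) (hit n B (i :: r))) ->
  blk (outer (i :: r)) (childhit n A r i).
Proof.
move=> IH; have -> : childhit n A r i = \bigcup_(e : 'rV[int]_2)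
    ([set w | step W (i :: r) w = e] `&` hit n [set x | A ((e : site 2) + x)] (i :: r)).
  apply/seteqP; split => [w Hw|w [e _ [/= <-]]//].
  by exists (step W (i :: r) w).
apply: blk_bigcup => e; apply: blkI.
  by apply: (sub_block _ (@blk_step _ _)) => _ ->; exists [::].
by apply: (sub_block _ (IH _)); exact: inner_outer.
Qed.

Lemma hit_succE n A r : hit n.+1 A r =
  \bigcup_i ([set w | (i < offspring W r w)%N] `&` childhit n A r i).
Proof.
apply/seteqP; split => [w [i iL Hi]|w [i _ [iL Hi]]]; first by exists i.
by exists i.
Qed.

Lemma blk_hit n A r : blk (inner r) (hit n A r).
Proof.
elim: n A r => [|n IH] A r.
  have [A0|nA0] := pselect (A 0).
    by rewrite (_ : hit 0 A r = setT); [exact: blkT|apply/seteqP; split => // w _].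
  rewrite (_ : hit 0 A r = ~` setT); first by apply: blkC; exact: blkT.
  by apply/seteqP; split => // w [].
rewrite hit_succE; apply: blk_bigcup => i; apply: blkI.
  by apply: (sub_block _ (@blk_offspring _ _)) => _ ->; left.
apply: (sub_block _ (@blk_childhit _ _ _ _ (fun B => IH B _))) => k ik.
by right; exists i.
Qed.

Lemma measurable_hit n A r : measurable (hit n A r).
Proof. exact: blk_measurable (@blk_hit n A r). Qed.

Lemma measurable_childhit n A r i : measurable (childhit n A r i).
Proof. exact: blk_measurable (@blk_childhit _ _ _ _ (fun B => @blk_hit n B _)). Qed.

Lemma measurable_step r e : measurable [set w | step W r w = e].
Proof. exact: blk_measurable (@blk_step e r). Qed.

Lemma step_prob r x : x \in nbr -> P [set w | step W r w = to_site x] = (5^-1)%:E.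
Proof.
by move=> xn; have := step_law W r (to_site x); rewrite near0_to_site.
Qed.

Lemma prob_split_seq r E (s : seq (int * int)) : measurable E -> uniq s ->
  P (E `&` [set w | exists2 x, x \in s & step W r w = to_site x]) =
  (\sum_(x <- s) P (E `&` [set w | step W r w = to_site x]))%E.
Proof.
move=> mE; elim: s => [_|x s IH /= /andP[xs us]].
  by rewrite big_nil (_ : _ `&` _ = set0) ?measure0// -subset0 => w [_ []].
rewrite big_cons -IH// -measureU//.
- congr (P _); rewrite -setIUr; congr (_ `&` _).
  apply/seteqP; split => [w [y]|w [/= wx|[y ys wy]]].
  + by rewrite inE => /orP[/eqP ->|ys] wy; [left|right; exists y].
  + by exists x => //; rewrite inE eqxx.
  + by exists y => //; rewrite inE ys orbT.
- by apply: measurableI => //; exact: measurable_step.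
- apply: measurableI => //.
  rewrite (_ : [set w | _] = \bigcup_(y in [set` s]) [set w | step W r w = to_site y]).
    by apply: fin_bigcup_measurable => // y _; exact: measurable_step.
  by apply/seteqP; split => [w [y ys E1]|w [y ys E1]]; exists y.
- rewrite -subset0 => w [[_ /= ->] [_ [y ys /to_site_inj xy]]].
  by rewrite xy ys in xs.
Qed.

(** The five neighbours exhaust the law of the step: their probabilities sum to 1, so the rest is a
    null event. *)
Lemma prob_split_step r E : measurable E ->
  P E = (\sum_(x <- nbr) P (E `&` [set w | step W r w = to_site x]))%E.
Proof.
move=> mE; rewrite -prob_split_seq//.
set N := [set w | _].
have mN : measurable N.
  rewrite /N (_ : [set w | _] = \bigcup_(y in [set` nbr]) [set w | step W r w = to_site y]).
    by apply: fin_bigcup_measurable => // y _; exact: measurable_step.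
  by apply/seteqP; split => [w [y ys E1]|w [y ys E1]]; exists y.
have PN : P N = 1%E.
  have := @prob_split_seq r setT nbr measurableT isT; rewrite setTI => ->.
  under eq_big_seq => x xn do rewrite setTI step_prob//.
  by rewrite sumEFin /nbr !big_cons big_nil; congr (_%:E); field.
have PNC : P (~` N) = 0%E by rewrite probability_setC// PN subee.
have PE : P (E `\` N) = 0%E.
  apply/eqP; rewrite -measure_le0 -PNC; apply: le_measure; rewrite ?inE.
  - exact: measurableD.
  - exact: measurableC.
  - by move=> w [].
apply: (etrans (measureDI P mE mN)).
by rewrite [X in (X + _)%E](_ : _ = 0%E) ?add0e.
Qed.

(** The success probability of a single child, averaged over its displacement; the empty label may
    stand for the child since the law does not depend on the label. *)
Definition child_prob n (A : set (site 2)) : R :=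
  5^-1 * \sum_(x <- nbr) fine (P (hit n [set y | A (to_site x + y)] [::])).

Section hit_law.
Variable n : nat.
(** The induction hypothesis of [prob_hit], in which it is discharged. *)
Hypothesis IH : forall A r, P (hit n A r) = P (hit n A [::]).

Lemma prob_childhit A r i : P (childhit n A r i) = (child_prob n A)%:E.
Proof.
rewrite (@prob_split_step (i :: r))//; last exact: measurable_childhit.
rewrite /child_prob mulr_sumr -sumEFin; apply: eq_big_seq => x xn.
have -> : childhit n A r i `&` [set w | step W (i :: r) w = to_site x] =
    [set w | step W (i :: r) w = to_site x] `&`
      hit n [set y | A (to_site x + y)] (i :: r).
  by apply/seteqP; split => w [] => [+ E|E +]; rewrite /childhit /= E.
rewrite (@blk_indep [set inr (i :: r)] (inner (i :: r))).
- by rewrite step_prob// IH EFinM fineK// fin_num_measure//; exact: measurable_hit.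
- by rewrite -subset0 => _ [-> /inr_notin_inner].
- exact: @blk_step.
- exact: @blk_hit.
Qed.

Lemma child_prob01 A : 0 <= child_prob n A <= 1.
Proof.
rewrite -!lee_fin -(prob_childhit A [::] 0) measure_ge0 probability_le1//.
exact: measurable_childhit.
Qed.

Definition nohit A r j : set T := \big[setI/setT]_(i < j) ~` childhit n A r i.

Lemma blk_nohit A r j :
  blk [set k | exists2 i, (i < j)%N & outer (i :: r) k] (nohit A r j).
Proof.
apply: (big_ind (blk _)) => [||i _]; [exact: blkT|exact: blkI|].
have Ci := @blk_childhit n A _ _ (fun B => @blk_hit n B (val i :: r)).
apply: (sub_block _ (blkC Ci)).
by move=> k ik; exists i.
Qed.

Lemma outer_lt_disjoint r j :
  outer (j :: r) `&` [set k | exists2 i, (i < j)%N & outer (i :: r) k] = set0.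
Proof.
rewrite -subset0 => k [jk [i ij ik]].
by rewrite -(@outer_disjoint j i r)//; rewrite gtn_eqF.
Qed.

(** Siblings are driven by disjoint blocks, so their failures are independent. *)
Lemma prob_nohit A r j : P (nohit A r j) = ((1 - child_prob n A) ^+ j)%:E.
Proof.
elim: j => [|j IHj]; first by rewrite /nohit big_ord0 probability_setT.
rewrite /nohit big_ord_recr /= setIC.
rewrite (blk_indep (@outer_lt_disjoint r j) _ (@blk_nohit A r j)).
  rewrite probability_setC ?prob_childhit; last exact: measurable_childhit.
  by rewrite IHj exprS.
by apply: blkC; apply: blk_childhit => B; exact: @blk_hit.
Qed.

Lemma prob_hit_succ A r : P (hit n.+1 A r) = success Q (child_prob n A).
Proof.
(* In [D j], child j is born and is the first to succeed; these disjoint events make up the hit. *)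
pose D j := [set w | (j < offspring W r w)%N] `&`
  (childhit n A r j `&` nohit A r j).
have nohitP j w : nohit A r j w <-> forall i, (i < j)%N -> ~ childhit n A r i w.
  rewrite /nohit -(bigcap_mkord j (fun i => ~` childhit n A r i)).
  by split => H i ij; exact: H.
have blkCN j : blk [set k | exists2 i, (i < j.+1)%N & outer (i :: r) k]
    (childhit n A r j `&` nohit A r j).
  apply: blkI.
    apply: (sub_block _ (@blk_childhit n A _ _ (fun B => @blk_hit n B (j :: r)))).
    by move=> k jk; exists j.
  apply: (sub_block _ (@blk_nohit A r j)).
  by move=> k [i ij ik]; exists i => //; exact: ltnW.
have mD j : measurable (D j).
  apply: measurableI; first exact: blk_measurable (@blk_offspring j r).
  exact: blk_measurable (blkCN j).
have hitE : hit n.+1 A r = \bigcup_j D j.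
  rewrite hit_succE; apply/seteqP; split => [w [i _ [iL Hi]]|w [j _ [jL [Hj _]]]].
    have ex : exists i, `[< (i < offspring W r w)%N /\ childhit n A r i w >].
      by exists i; apply/asboolP.
    case: (ex_minnP ex) => j /asboolP[jL Hj] jmin.
    exists j => //; split => //; split => //; apply/nohitP => i' i'j Hi'.
    have /jmin : `[< (i' < offspring W r w)%N /\ childhit n A r i' w >].
      by apply/asboolP; split => //; exact: ltn_trans i'j jL.
    by rewrite leqNgt i'j.
  by exists j.
have tD : trivIset setT D.
  apply/trivIsetP => i j _ _; wlog ij : i j / (i < j)%N => [H|_].
    by rewrite neq_ltn => /orP[ij|ji]; [|rewrite setIC]; apply: H; rewrite // neq_ltn ?ij ?ji.
  rewrite -subset0 => w [[_ [Hi _]] [_ [_ /nohitP /(_ _ ij)]]].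
  exact.
rewrite hitE measure_bigcup//.
rewrite /success; transitivity (\sum_(0 <= j <oo) P (D j))%E.
  by apply: eq_eseriesl => j; rewrite in_setT.
apply: eq_eseriesr => j _.
(* Three independent factors: the offspring number of r, the success of child j, and the failure of
   all children i < j. *)
rewrite (blk_indep _ (@blk_offspring j r) (blkCN j)); last first.
  by rewrite -subset0 => _ [-> [i _ /inl_notin_outer]].
rewrite (blk_indep (@outer_lt_disjoint r j) _ (@blk_nohit A r j)); last first.
  by apply: blk_childhit => B; exact: @blk_hit.
rewrite prob_childhit prob_nohit -EFinM [RHS]EFinM; congr (_ * _)%E.
have <- := tailE Q j; exact: (offspring_law W r [set l | (j < l)%N]).
Qed.

End hit_law.

Lemma prob_hit n A r : P (hit n A r) = P (hit n A [::]).
Proof.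
elim: n A r => [//|n IH] A r.
by rewrite !prob_hit_succ.
Qed.

Lemma success_hit n A :
  success Q (child_prob n A) = (fine (P (hit n.+1 A [::])))%:E.
Proof.
rewrite fineK; first by rewrite prob_hit_succ//; exact: prob_hit.
by apply: fin_num_measure; exact: measurable_hit.
Qed.

End brw_hit.

(** * Occupied sites *)

Definition coord (e : site 2) : int * int := (e ord0 ord0, e ord0 ord_max).

Lemma to_siteK : cancel to_site coord.
Proof. by move=> [a b]; rewrite /coord !mxE. Qed.

Lemma coordK : cancel coord to_site.
Proof.
move=> e; have [x ->] := to_site_surj e.
by rewrite to_siteK.
Qed.

Section occupation.
Context (d : measure_display) (T : measurableType d) (R : realType)
  (P : probability T R) (Q : probability nat R) (W : brw P 2 Q).

Fixpoint alive (v : seq nat) (w : T) : bool :=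
  if v is i :: v' then (i < offspring W v' w)%N && alive v' w else true.

Lemma mem_generation n w v :
  (v \in generation W n w) = (size v == n) && alive v w.
Proof.
elim: n v => [|n IH] v; first by rewrite inE; case: v.
apply/allpairsPdep/idP => [[v' [i [v'n ilt ->]]]|].
  move: v'n ilt; rewrite IH mem_iota /= => /andP[/eqP -> ->] ->.
  by rewrite eqxx.
case: v => // i v /= /andP[]; rewrite eqSS => vn /andP[il vw].
by exists v, i; rewrite IH vn vw mem_iota.
Qed.

Lemma hitP n A r w : alive r w ->
  hit W n A r w <-> exists u, [/\ size u = n, alive (u ++ r) w &
    A (position W (u ++ r) w - position W r w)].
Proof.
elim: n A r => [|n IH] A r rw /=.
  split=> [A0|[u [/size0nil -> _]]]; last by rewrite /= subrr.
  by exists [::]; rewrite /= subrr.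
split=> [[i il]|[u [un uw Au]]].
  have irw : alive (i :: r) w by rewrite /= il.
  move=> /(IH _ _ irw)[u [un uw Au]]; exists (rcons u i).
  rewrite size_rcons un cat_rcons; split => //.
  by move: Au; rewrite /= opprD addrCA [X in _ + X]addrC subrK.
(* Labels list the latest ancestor first, so the child of r on the way to [u ++ r] is the last
   letter of u. *)
case/lastP: u un uw Au => // u i; rewrite size_rcons cat_rcons => -[un] uw Au.
have irw : alive (i :: r) w.
  by elim: u {un Au} uw => // j u IHu /= /andP[_].
move: (irw) => /= /andP[il _]; exists i => //.
apply/(IH _ _ irw); exists u; split => //.
by rewrite /= opprD addrCA [X in _ + X]addrC subrK.
Qed.

Definition places n w : seq (int * int) :=
  undup [seq coord (position W v w) | v <- generation W n w].

Lemma occupiedE n w : occupied W n w = size (places n w).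
Proof.
rewrite /occupied /places.
have -> : [seq coord (position W v w) | v <- generation W n w] =
    map coord [seq position W v w | v <- generation W n w] by rewrite -map_comp.
by rewrite (undup_map_inj (can_inj coordK)) size_map.
Qed.

Lemma mem_places n w x : x \in places n w <-> hit W n [set to_site x] [::] w.
Proof.
rewrite mem_undup (@hitP n _ [::] w isT); split.
  move=> /mapP[v]; rewrite mem_generation => /andP[/eqP vn vw] ->.
  by exists v; rewrite cats0 subr0 /= coordK.
move=> [u []]; rewrite cats0 subr0 => un uw /= ux.
by apply/mapP; exists u; rewrite ?mem_generation ?un ?eqxx// ux to_siteK.
Qed.

Lemma survivesE n : survives W n = hit W n setT [::].
Proof.
apply/seteqP; split => w; rewrite /survives /=.
  case E : (generation W n w) => [//|v s] _; apply/(@hitP n _ [::] w isT).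
  have : v \in generation W n w by rewrite E mem_head.
  by rewrite mem_generation => /andP[/eqP vn vw]; exists v; rewrite cats0.
move=> /(@hitP n _ [::] w isT)[u []]; rewrite cats0 => un uw _.
have : u \in generation W n w by rewrite mem_generation un eqxx.
by case: (generation W n w).
Qed.

(** At least k sites are occupied when some duplicate-free list of k sites is hit entirely, and
    there are countably many lists. *)
Lemma measurable_occupied_ge n k : measurable [set w | (k <= occupied W n w)%N].
Proof.
rewrite (_ : [set w | _] = \bigcup_(s : seq (int * int))
    (if uniq s && (size s == k)
     then \bigcap_(x in [set` s]) hit W n [set to_site x] [::] else set0)).
  apply: countable_bigcupT_measurable => [|s]; first exact: countableP.
  case: ifP => // _; apply: fin_bigcap_measurable => // x _.
  exact: measurable_hit.
apply/seteqP; split => [w /= kw|w [s _]].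
  rewrite occupiedE in kw.
  exists (take k (places n w)) => //.
  rewrite take_uniq ?undup_uniq// size_takel// eqxx /= => x /= xs.
  by apply/mem_places; exact: mem_take xs.
case: ifP => // /andP[us /eqP <-] H; rewrite /= occupiedE uniq_leq_size//.
by move=> x xs; apply/mem_places; exact: H.
Qed.

Lemma measurable_occupied n (B : set nat) :
  measurable [set w | B (occupied W n w)].
Proof.
rewrite (_ : [set w | _] = \bigcup_(k in B)
   ([set w | (k <= occupied W n w)%N] `\` [set w | (k < occupied W n w)%N])).
  apply: bigcup_measurable => k _; apply: measurableD; exact: measurable_occupied_ge.
apply/seteqP; split => [w Bw|w [k Bk [/= k1 /negP]]].
  by exists (occupied W n w) => //; split; rewrite //= ltnn.
rewrite -leqNgt => k2.
by have -> : occupied W n w = k by apply/eqP; rewrite eqn_leq k1 k2.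
Qed.

Definition site_prob n x : R := fine (P (hit W n [set to_site x] [::])).

Lemma site_probE n x : P (hit W n [set to_site x] [::]) = (site_prob n x)%:E.
Proof. by rewrite fineK// fin_num_measure//; exact: measurable_hit. Qed.

Lemma child_prob_site n x :
  child_prob W n [set to_site x] = avg (site_prob n) x.
Proof.
congr (_ * _); apply: eq_bigr => e _; congr (fine (P (hit W n _ _))).
apply/seteqP; split => y /=; rewrite to_siteB.
  by move=> <-; rewrite addrAC subrr add0r.
by move=> ->; rewrite addrC subrK.
Qed.

Lemma site_prob0 : site_prob 0 0 = 1.
Proof.
rewrite /site_prob (_ : hit W 0 _ _ = setT) ?probability_setT//.
by apply/seteqP; split => // w _; rewrite /= to_site0.
Qed.

Definition surv_prob n : R := fine (P (hit W n setT [::])).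

Lemma surv_probE n : P (survives W n) = (surv_prob n)%:E.
Proof. by rewrite survivesE fineK// fin_num_measure//; exact: measurable_hit. Qed.

Lemma child_prob_setT n : child_prob W n setT = surv_prob n.
Proof. by rewrite /child_prob /nbr !big_cons big_nil /surv_prob; field. Qed.

(** * Recursions for survival and occupation *)

Hypotheses (Qmean : ('E_Q[fun l : nat => l%:R] = 1)%E)
  (Qvar : (0 < 'V_Q[fun l : nat => l%:R] < +oo)%E).

Let child01 n A := child_prob01 (fun A r => prob_hit W n A r) A.

(** For consecutive survival probabilities v and v', v - v' <= b v^2 and v' >= ([tail Q 0]) v, so
    1/v grows by at most b / [tail Q 0] in each generation. *)
Lemma surv_prob_ge : exists2 b : R, 0 < b &
  forall n, 0 < surv_prob n /\ (surv_prob n)^-1 <= 1 + b * n%:R.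
Proof.
have [b b0 bP] := sum_mul_tail_bounded Qmean Qvar.
have p0 := tail0_gt0 Qmean.
exists (b / tail Q 0) => [|n]; first by rewrite divr_gt0.
elim: n => [|n [v0 IH]].
  rewrite /surv_prob (_ : hit W 0 _ _ = setT) ?probability_setT//=.
  by rewrite invr1 mulr0 addr0.
have := success_hit W n setT; rewrite -/(surv_prob n.+1) => E.
have c01 := child01 n setT.
have g0 := success_ge_tail0 c01 E.
have gb := success_ge Qmean c01 E bP.
rewrite child_prob_setT in g0 gb.
set v := surv_prob n in v0 IH g0 gb *; set v' := surv_prob n.+1 in g0 gb *.
have v'0 : 0 < v' by apply: lt_le_trans g0; rewrite mulr_gt0.
split => //; rewrite -natr1 mulrDr mulr1 addrA.
apply: le_trans (lerD IH (lexx _)); rewrite -lerBlDl.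
have -> : v'^-1 - v^-1 = (v - v') / (v * v') by field; rewrite !gt_eqF.
rewrite ler_pdivrMr ?mulr_gt0// mulrAC ler_pdivlMr//.
have h1 : (v - v') * tail Q 0 <= b * v ^+ 2 * tail Q 0 by rewrite ler_pM2r//; lra.
have h2 : b * v * (tail Q 0 * v) <= b * v * v' by rewrite ler_wpM2l// mulr_ge0// ltW.
lra.
Qed.

Lemma site_prob_lower n x : tail Q 0 * avg (site_prob n) x <= site_prob n.+1 x.
Proof.
rewrite -child_prob_site; apply: (success_ge_tail0 (child01 n _)).
exact: success_hit.
Qed.

Lemma site_prob_upper n x : site_prob n.+1 x <=
  avg (site_prob n) x - tail Q 1 * avg (site_prob n) x ^+ 2.
Proof.
rewrite -child_prob_site; apply: (success_le Qmean (child01 n _)).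
exact: success_hit.
Qed.

(** Induction through [site_prob_upper]: outside [box n.+1] every neighbour lies outside [box n], so
    the average vanishes. *)
Lemma site_prob_support n x : x \notin box n -> site_prob n x = 0.
Proof.
elim: n x => [|n IH] x xn.
  rewrite /site_prob (_ : hit W 0 _ _ = set0) ?measure0//.
  apply/seteqP; split => // w /=; rewrite -to_site0 => /to_site_inj x0.
  by rewrite -x0 in xn.
apply/eqP; rewrite eq_le fine_ge0// andbT.
apply: le_trans (site_prob_upper n x) _.
have -> : avg (site_prob n) x = 0.
  rewrite /avg big1_seq ?mulr0// => e /= en; apply: IH.
  move: xn en; rewrite !mem_box; case: x => a b /= abn.
  rewrite !inE; case: e => e1 e2 /=; rewrite !xpair_eqE; lia.
by rewrite expr0n/= mulr0 subr0.
Qed.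

(** Almost surely the occupied sites lie in [box n], so the count is at most a sum of indicators
    over the box, and Markov's inequality applies. *)
Lemma occupied_markov n (a : R) : 0 < a ->
  (P [set w | (a < (occupied W n w)%:R)%R] <=
    ((\sum_(x <- box n) site_prob n x) / a)%:E)%E.
Proof.
move=> a0.
pose h x : set T := hit W n [set to_site x] [::].
have mh x : measurable (h x) by exact: measurable_hit.
(* Steps beyond the neighbours are excluded only almost surely. [F] runs through the sites off the
   box by their [pickle] codes; each is hit with probability 0, and the union N of these events is
   removed. *)
pose F k : set T := if @choice.unpickle (int * int)%type k is Some x
  then if x \in box n then set0 else h x else set0.
have mF k : measurable (F k) by rewrite /F; case: choice.unpickle => // x; case: ifP.
have mN : measurable (\bigcup_k F k) by exact: bigcupT_measurable.
have PN : P (\bigcup_k F k) = 0%E.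
  apply: measure_negligible => //; apply: negligible_bigcup => k.
  apply/negligibleP => //; rewrite /F; case: choice.unpickle => [x|]; rewrite ?measure0//.
  case: ifPn => xn; rewrite ?measure0//.
  by rewrite [LHS]site_probE site_prob_support.
set B := [set w | _].
have mB : measurable B by exact: (measurable_occupied n [set k | a < k%:R]).
set N := \bigcup_k F k in mN PN.
have mBN : measurable (B `\` N) by exact: measurableD.
have sub w : (B `\` N) w -> a <= \sum_(x <- box n) \1_(h x) w.
  move=> [aw Nw]; apply: (le_trans (ltW aw)); rewrite occupiedE.
  have -> : \sum_(x <- box n) (\1_(h x) w : R) =
      (size [seq x <- box n | w \in h x])%:R.
    rewrite size_filter -sum1_count natr_sum [RHS]big_mkcond /=.
    by apply: eq_bigr => x _; rewrite indicE; case: (_ \in _).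
  rewrite ler_nat; apply: uniq_leq_size; first exact: undup_uniq.
  move=> x /mem_places hx; rewrite mem_filter; apply/andP; split; first exact/mem_set.
  apply: contrapT => /negP xn; apply: Nw; exists (choice.pickle x) => //.
  by rewrite /F choice.pickleK (negbTE xn).
have -> : P B = P (B `\` N).
  apply/eqP; rewrite eq_le; apply/andP; split; last first.
    by apply: le_measure; rewrite ?inE// => w [].
  rewrite -[leRHS]adde0 -PN.
  apply: (@le_trans _ _ (P (B `\` N `|` N))).
    apply: le_measure; rewrite ?inE//; first exact: measurableU.
    by move=> w Bw; have [Nw|Nw] := pselect (N w); [right|left].
  exact: measureU2.
have : (a%:E * P (B `\` N) <= \sum_(x <- box n) P (h x))%E.
  have -> : (a%:E * P (B `\` N) = \int[P]_w (a * \1_(B `\` N) w)%:E)%E.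
    under eq_integral do rewrite EFinM.
    rewrite ge0_integralZl//; first by rewrite integral_indic// setIT.
    - apply/measurable_EFinP; exact: measurable_indic.
    - by rewrite lee_fin ltW.
  have -> : (\sum_(x <- box n) P (h x) = \int[P]_w (\sum_(x <- box n) \1_(h x) w)%:E)%E.
    under eq_integral do rewrite -sumEFin.
    rewrite ge0_integral_sum//; last by move=> x; apply/measurable_EFinP.
    by apply: eq_bigr => x _; rewrite integral_indic// setIT.
  apply: ge0_le_integral => //.
  - by move=> w _; rewrite lee_fin mulr_ge0// ltW.
  - by apply/measurable_EFinP; apply: measurable_funM.
  - by apply/measurable_EFinP; apply: measurable_sum => x; exact: measurable_indic.
  - move=> w _; rewrite lee_fin indicE; case: (boolP (w \in _)) => [/set_mem /sub|_].
      by rewrite mulr1.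
    by rewrite mulr0 sumr_ge0.
under eq_bigr do rewrite /h site_probE.
by rewrite sumEFin EFinM lee_pdivlMr// muleC.
Qed.

End occupation.

(** * Tightness given survival *)

Theorem theorem7 (d : measure_display) (T : measurableType d) (R : realType)
    (P : probability T R) (Q : probability nat R)
    (Qmean : ('E_Q[fun l : nat => l%:R] = 1)%E)
    (Qvar : (0 < 'V_Q[fun l : nat => l%:R] < +oo)%E)
    (W : brw P 2 Q) :
  bigOP_given P [set n : nat | (2 <= n)%N]
    (fun n w => (occupied W n w)%:R)
    (fun n => n%:R / ln n%:R)
    (fun n => survives W n).
Proof.
have [C C0 massC] : exists2 C : R, 0 < C & forall n, (2 <= n)%N ->
    \sum_(x <- box n) site_prob W n x <= C / ln n%:R.
  apply: (@total_mass_le R (site_prob W) (tail Q 0) (tail Q 1)).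
  - by move=> n x; exact: fine_ge0.
  - by move=> n x; exact: site_prob_support.
  - exact: site_prob0.
  - exact: tail0_gt0.
  - exact: tail1_gt0.
  - by move=> n x; exact: site_prob_lower.
  - by move=> n x; exact: site_prob_upper.
have [b b0 survb] := surv_prob_ge W Qmean Qvar.
(* Markov's inequality at level [A * (n / ln n)] bounds the bad event by C / (A n) = eps / ((1 + b)
   n), which is at most eps times the survival probability. *)
move=> eps eps0; pose A := C * (1 + b) / eps.
have A0 : 0 < A by rewrite !mulr_gt0 ?invr_gt0 ?addr_gt0.
exists `[0, A]%classic; first exact: segment_compact.
move=> n /= n2.
have n0 : 0 < n%:R :> R by rewrite ltr0n; lia.
have ln0 : 0 < ln (n%:R : R) by rewrite ln_gt0// ltr1n.
have [v0 vb] := survb n.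
rewrite /cond_distribution surv_probE inver gt_eqF// lee_pdivlMr// -EFinM.
set X := fun w => _; set v := surv_prob W n in v0 vb *.
pose a := A * (n%:R / ln n%:R).
have a0 : 0 < a by rewrite mulr_gt0// divr_gt0.
set bad := [set w | a < (occupied W n w)%:R].
have mbad : measurable bad by exact: (measurable_occupied W n [set k | a < k%:R]).
have msurv : measurable (survives W n) by rewrite survivesE; exact: measurable_hit.
have goodE : X @^-1` `[0, A]%classic = ~` bad.
  apply/seteqP; split => w; rewrite /X /bad /= in_itv /=.
    by move=> /andP[_]; rewrite ler_pdivrMr ?divr_gt0// leNgt => /negP.
  move=> /negP; rewrite -leNgt => wa; apply/andP; split.
    by rewrite divr_ge0// ltW// divr_gt0.
  by rewrite ler_pdivrMr ?divr_gt0.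
rewrite goodE.
have Pbad : (P bad <= (eps * v)%:E)%E.
  apply: le_trans (occupied_markov W Qmean Qvar n a0) _; rewrite lee_fin.
  rewrite ler_pdivrMr//; apply: le_trans (massC n n2) _.
  (* From 1/v <= 1 + bn <= (1 + b) n, as n >= 1. *)
  have vn : 1 <= v * ((1 + b) * n%:R).
    have : v^-1 <= (1 + b) * n%:R.
      by apply: le_trans vb _; rewrite mulrDl mul1r lerD2r ler1n; lia.
    by move=> vle; rewrite -{1}(mulfV (lt0r_neq0 v0)) ler_pM2l.
  have -> : eps * v * a = C / ln n%:R * (v * ((1 + b) * n%:R)).
    by rewrite /a /A; field; rewrite !gt_eqF.
  by rewrite ler_peMr// divr_ge0// ltW.
have : (P (survives W n) <= P (~` bad `&` survives W n) + P bad)%E.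
  apply: (@le_trans _ _ (P ((~` bad `&` survives W n) `|` bad))).
    apply: le_measure; rewrite ?inE//.
      by apply: measurableU => //; apply: measurableI => //; exact: measurableC.
    by move=> w Sw; have [|] := pselect (bad w); [right|left].
  by apply: measureU2 => //; apply: measurableI => //; exact: measurableC.
rewrite surv_probE -/v => H.
have -> : ((1 - eps) * v)%:E = (v%:E - (eps * v)%:E)%E.
  by rewrite -EFinB mulrBl mul1r.
rewrite leeBlDr//; apply: le_trans H _.
by rewrite leeD2l.
Qed.
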